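(* Let $L$ be a finitely algebraizable logic in a language $\tau$, with equivalent algebraic semantics the quasivariety $\mathcal{Q}$. Let $\Sigma$ be a set of EFD-sentences in $\tau$. Then the algebraic expansion $L^\Sigma$ is algebraizable with the same equivalence formulas and defining equations as $L$, and its equivalent algebraic semantics is the quasivariety $\mathcal{Q}^\Sigma$. Moreover, there is a one-to-one correspondence between the algebraic expansions of $L$ and the algebraic expansions of $\mathcal{Q}$.
   Context: A logic is a finitary structural consequence relation on the formulas of a language. An EFD-sentence (equational function definition sentence) in $\tau$ is a sentence $\forall x_1\dots x_n\exists! z_1\dots z_m \bigwedge_{i=1}^k s_i(\bar x,\bar z)=t_i(\bar x,\bar z)$ with $s_i,t_i$ $\tau$-terms, $n\ge 0$, $m\ge 1$. For such $\varphi$, $U(\varphi)$ is the sentence $\forall\bar x\bar y\bar z\,(\bigwedge_i s_i(\bar x,\bar y)=t_i(\bar x,\bar y)\wedge\bigwedge_i s_i(\bar x,\bar z)=t_i(\bar x,\bar z)\to \bar y=\bar z)$, and $E_\varphi$ is the set of identities $\forall\bar x\, s_i(\bar x,f_1^\varphi(\bar x),\dots,f_m^\varphi(\bar x))=t_i(\bar x,f_1^\varphi(\bar x),\dots,f_m^\varphi(\bar x))$, $1\le i\le k$, where $f^\varphi_1,\dots,f^\varphi_m$ are new $n$-ary function symbols. For a quasivariety $\mathcal{Q}$ axiomatized by quasi-identities $\Gamma$ and a set $\Sigma$ of EFD-sentences, the algebraic expansion $\mathcal{Q}^\Sigma$ is the class of models, in the language $\tau_\Sigma$ obtained by adding all the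 $f^\varphi_j$ ($\varphi\in\Sigma$, distinct symbols for distinct $\varphi$), of $\Gamma\cup\bigcup_{\varphi\in\Sigma}E_\varphi\cup\{U(\varphi):\varphi\in\Sigma\}$. For an algebraizable logic $L$ with a set of equivalence formulas $\Delta(x,y)$ and a finite set $\Phi(\bar x,\bar z)$ of formulas in variables $x_1,\dots,x_n,z_1,\dots,z_m$, $L^\Phi$ is the least logic containing $L$ (in the language expanded by new $n$-ary symbols $f^\Phi_1,\dots,f^\Phi_m$) such that $\vdash \Phi(\bar x,f^\Phi_1(\bar x),\dots,f^\Phi_m(\bar x))$ and $\Phi(\bar x,\bar y),\Phi(\bar x,\bar z)\vdash \bigcup_{j}\Delta(y_j,z_j)$; for a set $\Sigma$ of such finite sets, $L^\Sigma$ is the least logic containing all $L^\Phi$, $\Phi\in\Sigma$ (with distinct new symbols); these are the algebraic expansions of $L$. For an EFD-sentence $\varphi=\forall\bar x\exists!\bar z\bigwedge_{i}s_i=t_i$, let $d(\varphi):=\bigcup_i\Delta(s_i,t_i)$; for a set $\Sigma$ of EFD-sentences, $L^\Sigma$ means $L^{\{d(\varphi):\varphi\in\Sigma\}}$ (this does not depend on the choice of $\Delta$). *)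

(* Defs.v *)
From Stdlib Require List.
From mathcomp Require Import all_boot.
From mathcomp Require Import classical_sets cardinality.

Set Implicit Arguments.
Unset Strict Implicit.
Unset Printing Implicit Defensive.

Local Open Scope classical_set_scope.

Record signature := Signature { sym : Type; arity : sym -> nat }.

Inductive term (S : signature) (V : Type) : Type :=
| Var of V
| App (f : sym S) of ('I_(arity f) -> term S V).

Arguments Var {S V}.
Arguments App {S V}.

Definition equation (S : signature) (V : Type) : Type := (term S V * term S V)%type.

Definition formula (S : signature) : Type := term S nat.

Fixpoint subst (S : signature) (V W : Type) (s : V -> term S W)
    (t : term S V) : term S W :=
  match t with
  | Var x => s x
  | App f a => App f (fun k => subst s (a k))
  end.

Definition subst_eq (S : signature) (V W : Type) (s : V -> term S W)
    (e : equation S V) : equation S W :=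
  (subst s e.1, subst s e.2).

(* Maps between languages are presented as symbol-to-term assignments to avoid
   casts on arities.  Only inclusions of languages are used below, that is,
   assignments of the form f |-> g(x_1, ..., x_k). *)
Definition translation (S T : signature) : Type :=
  forall f : sym S, term T 'I_(arity f).

Fixpoint translate (S T : signature) (h : translation S T) (V : Type)
    (t : term S V) : term T V :=
  match t with
  | Var x => Var x
  | App f a => subst (fun k => translate h (a k)) (h f)
  end.

Definition translate_eq (S T : signature) (h : translation S T) (V : Type)
    (e : equation S V) : equation T V :=
  (translate h e.1, translate h e.2).

Record algebra (S : signature) := Algebra {
  carrier :> Type;
  carrier_inhabited : inhabited carrier;
  op : forall f : sym S, ('I_(arity f) -> carrier) -> carrier }.

Fixpoint eval (S : signature) (A : algebra S) (V : Type) (v : V -> A)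
    (t : term S V) : A :=
  match t with
  | Var x => v x
  | App f a => op (fun k => eval v (a k))
  end.

Definition sat_eq (S : signature) (A : algebra S) (V : Type) (v : V -> A)
    (e : equation S V) : Prop :=
  eval v e.1 = eval v e.2.

Definition algebra_class (S : signature) : Type := algebra S -> Prop.

Record quasi_identity (S : signature) := QuasiIdentity {
  premises : seq (equation S nat);
  conclusion : equation S nat }.

Definition translate_qi (S T : signature) (h : translation S T)
    (q : quasi_identity S) : quasi_identity T :=
  QuasiIdentity (map (translate_eq h (V:=nat)) (premises q))
                (translate_eq h (conclusion q)).

Definition sat_qi (S : signature) (A : algebra S) (q : quasi_identity S) : Prop :=
  forall v : nat -> A,
    (forall e, List.In e (premises q) -> sat_eq v e) -> sat_eq v (conclusion q).

Definition Mod (S : signature) (Gamma : set (quasi_identity S)) : algebra_class S :=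
  fun A => forall q, Gamma q -> sat_qi A q.

Definition quasivariety (S : signature) (K : algebra_class S) : Prop :=
  exists Gamma : set (quasi_identity S), forall A, K A <-> Mod Gamma A.

Definition eq_consequence (S : signature) (K : algebra_class S)
    (H : set (equation S nat)) (e : equation S nat) : Prop :=
  forall A, K A -> forall v : nat -> A,
    (forall e', H e' -> sat_eq v e') -> sat_eq v e.

Definition consequence (S : signature) : Type :=
  set (formula S) -> formula S -> Prop.

Record is_logic (S : signature) (C : consequence S) : Prop := IsLogic {
  logic_refl : forall G p, G p -> C G p;
  logic_mono : forall G H p, G `<=` H -> C G p -> C H p;
  logic_cut : forall G H p, (forall q, H q -> C G q) -> C H p -> C G p;
  logic_structural : forall (s : nat -> formula S) G p,
    C G p -> C (subst s @` G) (subst s p);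
  logic_finitary : forall G p, C G p ->
    exists H, [/\ finite_set H, H `<=` G & C H p] }.

Definition contains (S : signature) (C D : consequence S) : Prop :=
  forall G p, D G p -> C G p.

(* The intersection of all logics containing the rules R.  Finitarity is not
   preserved by arbitrary intersections; it is when the rules of R have finitely
   many premises up to weakening, as is the case for all R considered here. *)
Definition least_logic (S : signature) (R : consequence S) : consequence S :=
  fun G p => forall C, is_logic C -> contains C R -> C G p.

Definition image_logic (S T : signature) (h : translation S T)
    (C : consequence S) : consequence T :=
  fun G p => exists G0 p0,
    [/\ C G0 p0, G = translate h (V:=nat) @` G0 & p = translate h p0].

(* Delta(x, y) is a set of terms in two variables, E(x) a set of equations in
   one variable. *)
Definition equiv_inst (S : signature) (V : Type) (Delta : set (term S 'I_2))
    (s t : term S V) : set (term S V) :=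
  subst (fun k : 'I_2 => nth s [:: s; t] k) @` Delta.

Definition defining_inst (S : signature) (V : Type) (E : set (equation S 'I_1))
    (p : term S V) : set (equation S V) :=
  subst_eq (fun=> p) @` E.

(* C is an algebraizable logic with equivalence formulas Delta and defining
   equations E, and the quasivariety K is its equivalent algebraic semantics
   (Blok and Pigozzi). *)
Record algebraized_by (S : signature) (C : consequence S) (K : algebra_class S)
    (Delta : set (term S 'I_2)) (E : set (equation S 'I_1)) : Prop :=
  AlgebraizedBy {
  alg_logic : is_logic C;
  alg_quasivariety : quasivariety K;
  alg_complete : forall G p,
    C G p <-> (forall e, defining_inst E p e ->
                 eq_consequence K (\bigcup_(q in G) defining_inst E q) e);
  alg_equiv_sound : forall (s t : formula S) e,
    (\bigcup_(q in equiv_inst Delta s t) defining_inst E q) e ->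
    eq_consequence K [set (s, t)] e;
  alg_equiv_complete : forall s t : formula S,
    eq_consequence K (\bigcup_(q in equiv_inst Delta s t) defining_inst E q)
      (s, t) }.

(* The expansion of S by, for every i : I, m i new symbols of arity n i. *)
Definition expand (S : signature) (I : Type) (n m : I -> nat) : signature :=
  Signature (sym := (sym S + {i : I & 'I_(m i)})%type)
    (fun f => match f with inl f => arity f | inr g => n (tag g) end).

Definition new_sym (S : signature) (I : Type) (n m : I -> nat) (i : I)
    (j : 'I_(m i)) : sym (expand S n m) :=
  inr (Tagged (fun i => 'I_(m i)) j).

Definition incl (S : signature) (I : Type) (n m : I -> nat) :
    translation S (expand S n m) :=
  fun f => @App (expand S n m) 'I_(arity f) (inl f) Var.
Arguments incl S {I} n m.

Definition expand1 (S : signature) (n m : nat) : signature :=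
  expand S (fun _ : unit => n) (fun _ : unit => m).

Definition incl1 (S : signature) (I : Type) (n m : I -> nat) (i : I) :
    translation (expand1 S (n i) (m i)) (expand S n m) :=
  fun f => match f return term (expand S n m) 'I_(@arity (expand1 S (n i) (m i)) f) with
  | inl f => @App (expand S n m) 'I_(@arity S f) (inl f) Var
  | inr g => @App (expand S n m) 'I_(n i) (new_sym S n (tagged g)) Var
  end.
Arguments incl1 S {I} n m i.

(* In a term over 'I_n + 'I_m the left variables are x_1, ..., x_n and the right
   ones are z_1, ..., z_m. *)
Definition new_terms (S : signature) (n m : nat) (v : 'I_n + 'I_m) :
    formula (expand1 S n m) :=
  match v with
  | inl k => Var (k : nat)
  | inr j => @App (expand1 S n m) nat
      (@new_sym S unit (fun=> n) (fun=> m) tt j) (fun k => Var (k : nat))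
  end.

Definition fresh_vars (S : signature) (n m off : nat) (v : 'I_n + 'I_m) :
    formula S :=
  match v with inl k => Var (k : nat) | inr j => Var (off + j)%N end.

(* With x_k, y_j, z_j the variables of index k, n + j and n + m + j, the rules
   |- Phi(x, f(x))  and  Phi(x, y), Phi(x, z) |- Delta(y_j, z_j). *)
Inductive implicit_rules (S : signature) (Delta : set (term S 'I_2)) (n m : nat)
    (Phi : set (term S ('I_n + 'I_m))) : consequence (expand1 S n m) :=
| rule_exists p of Phi p :
    implicit_rules Delta Phi set0
      (subst (@new_terms S n m) (translate (incl S (fun _ : unit => n) (fun=> m)) p))
| rule_unique (j : 'I_m) q of
    equiv_inst (translate (incl S (fun _ : unit => n) (fun=> m)) (V:=_) @` Delta)
      (Var (n + j)%N) (Var (n + m + j)%N) q :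
    implicit_rules Delta Phi
      ((fun p => subst (@fresh_vars _ n m n)
                   (translate (incl S (fun _ : unit => n) (fun=> m)) p)) @` Phi `|`
       (fun p => subst (@fresh_vars _ n m (n + m))
                   (translate (incl S (fun _ : unit => n) (fun=> m)) p)) @` Phi) q.

(* L^Phi for a single Phi. *)
Definition logic_expansion1 (S : signature) (L : consequence S)
    (Delta : set (term S 'I_2)) (n m : nat) (Phi : set (term S ('I_n + 'I_m))) :
    consequence (expand1 S n m) :=
  least_logic (fun G p =>
    image_logic (incl S (fun _ : unit => n) (fun=> m)) L G p \/ implicit_rules Delta Phi G p).

(* L^Phi for a family Phi.  L is listed among the generators so that the
   expansion by the empty family is L. *)
Definition logic_expansion (S : signature) (L : consequence S)
    (Delta : set (term S 'I_2)) (I : Type) (n m : I -> nat)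
    (Phi : forall i, set (term S ('I_(n i) + 'I_(m i)))) :
    consequence (expand S n m) :=
  least_logic (fun G p =>
    image_logic (incl S n m) L G p \/
    exists i, image_logic (incl1 S n m i) (logic_expansion1 L Delta (Phi i)) G p).

(* The list of equations s_i(x, z) = t_i(x, z) of an EFD-sentence
   forall x exists! z, /\_i s_i(x, z) = t_i(x, z). *)
Definition efd_matrix (S : signature) (n m : nat) : Type :=
  seq (equation S ('I_n + 'I_m)).

Record efd_sentence (S : signature) := EFD {
  efd_n : nat;
  efd_m : nat;
  efd_m_gt0 : (0 < efd_m)%N;
  efd_eqs : efd_matrix S efd_n efd_m }.

Definition efd_formulas (S : signature) (Delta : set (term S 'I_2)) (n m : nat)
    (phi : efd_matrix S n m) : set (term S ('I_n + 'I_m)) :=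
  \bigcup_(e in [set e | List.In e phi]) equiv_inst Delta e.1 e.2.

Definition join_val (A : Type) (n m : nat) (x : 'I_n -> A) (z : 'I_m -> A)
    (v : 'I_n + 'I_m) : A :=
  match v with inl k => x k | inr j => z j end.

(* The identities E_phi, where phi is the i-th sentence of a family. *)
Definition sat_E (S : signature) (I : Type) (n m : I -> nat) (i : I)
    (A : algebra (expand S n m)) (phi : efd_matrix S (n i) (m i)) : Prop :=
  forall x : 'I_(n i) -> A, forall e, List.In e phi ->
    sat_eq (join_val x (fun j => @op _ A (new_sym S n j) x))
      (translate_eq (incl S n m) e).

(* The sentence U(phi). *)
Definition sat_U (S : signature) (I : Type) (n m : I -> nat) (i : I)
    (A : algebra (expand S n m)) (phi : efd_matrix S (n i) (m i)) : Prop :=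
  forall (x : 'I_(n i) -> A) (y z : 'I_(m i) -> A),
    (forall e, List.In e phi ->
       sat_eq (join_val x y) (translate_eq (incl S n m) e)) ->
    (forall e, List.In e phi ->
       sat_eq (join_val x z) (translate_eq (incl S n m) e)) ->
    forall j, y j = z j.

Definition class_expansion (S : signature) (Gamma : set (quasi_identity S))
    (I : Type) (n m : I -> nat) (phi : forall i, efd_matrix S (n i) (m i)) :
    algebra_class (expand S n m) :=
  fun A => Mod (translate_qi (incl S n m) @` Gamma) A /\
           forall i, sat_E A (phi i) /\ sat_U A (phi i).

(* A set Sigma of EFD-sentences is a family indexed by its own elements. *)
Section ExpansionBySet.
Variables (S : signature) (Sigma : set (efd_sentence S)).

Definition set_index : Type := {phi : efd_sentence S | Sigma phi}.
Definition set_n (i : set_index) : nat := efd_n (sval i).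
Definition set_m (i : set_index) : nat := efd_m (sval i).
Definition set_eqs (i : set_index) : efd_matrix S (set_n i) (set_m i) :=
  efd_eqs (sval i).

Definition set_expand : signature := expand S set_n set_m.

Definition set_incl : translation S set_expand := incl S set_n set_m.

Definition set_logic_expansion (L : consequence S) (Delta : set (term S 'I_2)) :
    consequence set_expand :=
  logic_expansion L Delta (fun i => efd_formulas Delta (set_eqs i)).

Definition set_class_expansion (Gamma : set (quasi_identity S)) :
    algebra_class set_expand :=
  class_expansion Gamma set_eqs.

End ExpansionBySet.

Arguments set_logic_expansion {S} Sigma L Delta.
Arguments set_class_expansion {S} Sigma Gamma.

Definition is_logic_expansion (S : signature) (L : consequence S)
    (Delta : set (term S 'I_2)) (I : Type) (n m : I -> nat)
    (C : consequence (expand S n m)) : Prop :=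
  exists Phi : forall i, set (term S ('I_(n i) + 'I_(m i))),
    (forall i, finite_set (Phi i)) /\ C = logic_expansion L Delta Phi.

Definition is_class_expansion (S : signature) (Gamma : set (quasi_identity S))
    (I : Type) (n m : I -> nat) (K : algebra_class (expand S n m)) : Prop :=
  exists phi : forall i, efd_matrix S (n i) (m i), K = class_expansion Gamma phi.

Definition one_to_one (X Y : Type) (P : X -> Prop) (Q : Y -> Prop)
    (R : X -> Y -> Prop) : Prop :=
  (forall x, P x -> exists! y, Q y /\ R x y) /\
  (forall y, Q y -> exists! x, P x /\ R x y).

(* Main.v *)
Require Import Defs.
From mathcomp Require Import all_boot.
From mathcomp Require Import boolp classical_sets cardinality.

Set Implicit Arguments.
Unset Strict Implicit.
Unset Printing Implicit Defensive.

Local Open Scope classical_set_scope.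

(* Both the expanded logic and the expanded class are computed semantically.
   The class of expansions is again a quasivariety, so the logic it induces
   through the defining equations is finitary, and it satisfies the rules
   generating the expanded logic.  Conversely, let F be the theory of a set of
   formulas in any logic D with these rules.  Seen in the language of L, F is an
   L-filter on the term algebra, so Delta defines a congruence whose quotient
   lies in the quasivariety of L and in which F is the preimage of the
   designated elements.  The uniqueness rule makes this congruence compatible
   with the new symbols, because f(x) and f(x') solve the same equations in the
   quotient when x and x' are congruent; the quotient is thus a model of the
   expanded class, which refutes whatever does not belong to F.
   The correspondence is one-to-one because, with Delta and E fixed, a logic and
   a quasivariety determine each other. *)

(** * Lists and finite sets *)

Lemma In_mem (T : eqType) (x : T) (s : seq T) : List.In x s <-> x \in s.
Proof.
elim: s => [|y s IHs] //=; rewrite inE; split.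
  by case=> [->|/IHs ->]; rewrite ?eqxx ?orbT.
by case/orP=> [/eqP ->|/IHs]; [left|right].
Qed.

Lemma In_map (T U : Type) (f : T -> U) (s : seq T) y :
  List.In y (map f s) <-> exists2 x, List.In x s & f x = y.
Proof.
elim: s => [|x s IHs] /=; first by split=> [|[]].
split=> [[<-|/IHs [z zs <-]]|[z [<-|zs] zy]].
- by exists x; [left|].
- by exists z; [right|].
- by left.
- by right; apply/IHs; exists z.
Qed.

Lemma finite_In (T : Type) (s : seq T) : finite_set [set x | List.In x s].
Proof.
elim: s => [|x s IHs].
  by have -> : [set x : T | List.In x [::]] = set0 by apply/seteqP; split.
suff -> : [set y | List.In y (x :: s)] = [set x] `|` [set y | List.In y s].
  by rewrite finite_setU; split=> //; apply: finite_set1.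
by apply/seteqP; split=> y [->|ys]; [left|right|left|right].
Qed.

Lemma finite_set_seq (T : Type) (A : set T) :
  finite_set A -> exists s : seq T, forall x, A x <-> List.In x s.
Proof.
move=> finA; have [s As] := (finite_seqP (A : set {classic T})).1 finA.
exists s => x; have -> : A x = ((x : {classic T}) \in s) :> Prop by rewrite As.
by split=> xs; apply/(@In_mem {classic T}).
Qed.

(** The support is the union of supports chosen over the finite set [D]; monotonicity of [P] lets
    each element use the larger set. *)
Lemma finite_support (T U : Type) (D : set U) (G : set T) (P : set T -> U -> Prop) :
    finite_set D -> (forall H H' u, H `<=` H' -> P H u -> P H' u) ->
    (forall u, D u -> exists H, [/\ finite_set H, H `<=` G & P H u]) ->
  exists H, [/\ finite_set H, H `<=` G & forall u, D u -> P H u].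
Proof.
move=> finD Pmono DP.
have /choice [H HP] : forall u, exists H,
    D u -> [/\ finite_set H, H `<=` G & P H u].
  by move=> u; have [/DP [H ?]|nDu] := pselect (D u); [exists H|exists set0].
exists (\bigcup_(u in D) H u); split.
- by apply: bigcup_finite => // u /HP [].
- by move=> x [u /HP [_ HG _]] /HG.
- move=> u Du; have [_ _] := HP u Du.
  by apply: Pmono => x Hx; exists u.
Qed.

(** * Evaluation, substitution and change of language *)

Section Substitution.
Variable S : signature.

Lemma eval_ext (A : algebra S) (V : Type) (v w : V -> A) t :
  (forall x, v x = w x) -> eval v t = eval w t.
Proof. by move=> vw; congr (eval _ t); apply/funext. Qed.

Lemma eval_subst (A : algebra S) (V W : Type) (v : W -> A) (s : V -> term S W) t :
  eval v (subst s t) = eval (fun x => eval v (s x)) t.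
Proof. by elim: t => //= f a IHa; congr (op _); apply/funext. Qed.

Definition term_algebra (V : Type) (x : V) : algebra S :=
  @Algebra S (term S V) (inhabits (Var x)) (fun f a => App f a).

Lemma eval_term_algebra (V W : Type) (x : V) (s : W -> term_algebra x) t :
  eval s t = subst s t.
Proof. by elim: t => //= f a IHa; congr App; apply/funext. Qed.

Lemma subst_Var (V : Type) (t : term S V) : subst Var t = t.
Proof. by elim: t => //= f a IHa; congr App; apply/funext. Qed.

Lemma sat_subst (A : algebra S) (V W : Type) (v : W -> A) (s : V -> term S W)
    (e : equation S V) :
  sat_eq v (subst_eq s e) = sat_eq (fun x => eval v (s x)) e.
Proof. by rewrite /sat_eq /= !eval_subst. Qed.

End Substitution.

Arguments term_algebra : clear implicits.

Section Translation.
Variables (S T : signature) (h : translation S T).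

(** For an inclusion of languages this is the usual reduct. The carrier is that of [A] itself, so
    valuations need no casts. *)
Definition reduct (A : algebra T) : algebra S :=
  @Algebra S A (carrier_inhabited A) (fun f a => eval a (h f)).

Lemma eval_translate (A : algebra T) (V : Type) (v : V -> A) (t : term S V) :
  eval v (translate h t) = eval (v : V -> reduct A) t.
Proof.
elim: t => //= f a IHa; rewrite eval_subst.
by congr (eval _ (h f)); apply/funext.
Qed.

Lemma sat_translate (A : algebra T) (V : Type) (v : V -> A) (e : equation S V) :
  sat_eq v (translate_eq h e) = sat_eq (v : V -> reduct A) e.
Proof. by rewrite /sat_eq /= !eval_translate. Qed.

Lemma Mod_translate (A : algebra T) (Gamma : set (quasi_identity S)) :
  Mod (translate_qi h @` Gamma) A <-> Mod Gamma (reduct A).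
Proof.
have sat q : sat_qi A (translate_qi h q) <-> sat_qi (reduct A) q.
  split=> qA v prem.
    move/(_ v): qA; rewrite sat_translate; apply=> e /In_map [e' e'q <-].
    by rewrite sat_translate; apply: prem.
  rewrite sat_translate; apply: qA => e eq.
  by rewrite -sat_translate; apply: prem; apply/In_map; exists e.
split=> AG q qG; first by apply/sat/AG; exists q.
by case: qG => q' /AG q'A <-; apply/sat.
Qed.

End Translation.

Lemma subst_subst (S : signature) (U V W : Type) (s : V -> term S W)
    (r : U -> term S V) t :
  subst s (subst r t) = subst (fun x => subst s (r x)) t.
Proof. by elim: t => //= f a IHa; congr App; apply/funext. Qed.

Lemma translate_subst (S T : signature) (h : translation S T) (V W : Type)
    (s : V -> term S W) t :
  translate h (subst s t) = subst (fun x => translate h (s x)) (translate h t).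
Proof.
elim: t => //= f a IHa; rewrite subst_subst.
by congr (subst _ (h f)); apply/funext.
Qed.

(** * Quotients by congruences *)

Lemma quotient_exists (T : Type) (R : T -> T -> Prop) :
    (forall x, R x x) -> (forall x y, R x y -> R y x) ->
    (forall x y z, R x y -> R y z -> R x z) ->
  exists (Q : Type) (pi : T -> Q) (r : Q -> T),
    (forall q, pi (r q) = q) /\ (forall x y, pi x = pi y <-> R x y).
Proof.
move=> Rrefl Rsym Rtrans.
pose Q := {c : set T | exists x, c = R x}.
pose pi x : Q := exist _ (R x) (ex_intro _ x erefl).
have piP x y : pi x = pi y <-> R x y.
  split=> [/(congr1 sval) /= ->|Rxy]; first exact: Rrefl.
  apply: eq_exist => /=; apply/seteqP; split=> z Rz; last exact: Rtrans Rz.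
  exact: Rtrans (Rsym _ _ Rxy) Rz.
have /choice [r rK] : forall q : Q, exists x, pi x = q.
  by case=> c [x cE]; exists x; apply: eq_exist.
by exists Q, pi, r.
Qed.

(** Operations on classes are computed on the representatives picked by [r]; compatibility of [R]
    makes the projection a homomorphism. *)
Lemma algebra_quotient (S : signature) (B : algebra S) (R : B -> B -> Prop) :
    (forall x, R x x) -> (forall x y, R x y -> R y x) ->
    (forall x y z, R x y -> R y z -> R x z) ->
    (forall f a b, (forall k, R (a k) (b k)) -> R (op (f:=f) a) (op (f:=f) b)) ->
  exists (M : algebra S) (pi : B -> M) (r : M -> B),
    [/\ forall q, pi (r q) = q,
        forall (V : Type) (v : V -> B) t, eval (pi \o v) t = pi (eval v t)
      & forall x y, pi x = pi y <-> R x y].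
Proof.
move=> Rrefl Rsym Rtrans Rop.
have [Q [pi [r [rK piP]]]] := quotient_exists Rrefl Rsym Rtrans.
have inhQ : inhabited Q by case: (carrier_inhabited B) => x; apply: inhabits (pi x).
exists (@Algebra S Q inhQ (fun f a => pi (op (f:=f) (r \o a)))), pi, r; split=> //.
move=> V v; elim=> //= f a IHa; apply/piP/Rop => k /=.
by apply/piP; rewrite rK -IHa.
Qed.

(** * Filters of an algebraizable logic and their congruences *)

Section DeductiveFilters.
Variables (S : signature) (L : consequence S) (Gamma : set (quasi_identity S)).
Variables (Delta : set (term S 'I_2)) (E : set (equation S 'I_1)).
Hypothesis algL : algebraized_by L (Mod Gamma) Delta E.

(** The truth set of the matrix that [E] defines on [A]. *)
Definition designated (A : algebra S) (a : A) : Prop :=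
  forall e, E e -> sat_eq (fun=> a) e.

Definition pair_val (A : Type) (a b : A) (k : 'I_2) : A := nth a [:: a; b] k.

Lemma comp_pair_val (A B : Type) (f : A -> B) a b :
  f \o pair_val a b = pair_val (f a) (f b).
Proof. by apply/funext; case; case=> [|[]]. Qed.

Lemma designated_inst (A : algebra S) (V : Type) (v : V -> A) p :
  (forall e, defining_inst E p e -> sat_eq v e) <-> designated (eval v p).
Proof.
split=> [pE e Ee|pE _ [e Ee <-]]; last by rewrite sat_subst; apply: pE.
by rewrite -[sat_eq _ _]sat_subst; apply: pE; exists e.
Qed.

Lemma designated_bigcup (A : algebra S) (V : Type) (v : V -> A) G :
  (forall e, (\bigcup_(q in G) defining_inst E q) e -> sat_eq v e) <->
  (forall q, G q -> designated (eval v q)).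
Proof.
split=> [GE q Gq|GE e [q Gq]]; last by apply: (designated_inst v q).2 => //; apply: GE.
by apply/designated_inst => e qe; apply: GE; exists q.
Qed.

Lemma logic_designated G p :
  L G p <-> forall A, Mod Gamma A -> forall v : nat -> A,
    (forall q, G q -> designated (eval v q)) -> designated (eval v p).
Proof.
split=> [/(alg_complete algL) LGp A AG v Gv|Gp].
  by apply/designated_inst => e /LGp; apply=> //; apply/designated_bigcup.
apply/(alg_complete algL) => e pe A AG v /designated_bigcup Gv.
exact: ((designated_inst v p).2 (Gp A AG v Gv) e pe).
Qed.

Lemma eval_equiv_inst (A : algebra S) (V : Type) (v : V -> A) s t (d : term S 'I_2) :
  eval v (subst (fun k : 'I_2 => nth s [:: s; t] k) d) =
  eval (pair_val (eval v s) (eval v t)) d.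
Proof. by rewrite eval_subst -comp_pair_val. Qed.

Lemma eq_designated (A : algebra S) (a b : A) : Mod Gamma A ->
  a = b <-> forall d, Delta d -> designated (eval (pair_val a b) d).
Proof.
(* Variables 0 and 1 name [a] and [b], so the conditions on [Delta], stated for formulas, apply to
   elements. *)
move=> AG; pose v (k : nat) := nth a [:: a; b] k.
split=> [ab d Dd|abD].
  rewrite -(eval_equiv_inst v (Var 0) (Var 1)); apply/designated_inst => e de.
  apply: (alg_equiv_sound algL (s:=Var 0) (t:=Var 1) _ AG (v:=v)) => [|_ ->] //.
  by exists (subst (fun k : 'I_2 => nth (Var 0) [:: Var 0; Var 1] k) d); first exists d.
apply: (alg_equiv_complete algL (s:=Var 0) (t:=Var 1) AG (v:=v)).
by apply/designated_bigcup => _ [d Dd <-]; rewrite eval_equiv_inst; apply: abD.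
Qed.

Lemma equiv_instP (A : algebra S) (V : Type) (v : V -> A) s t : Mod Gamma A ->
  eval v s = eval v t <->
  forall q, equiv_inst Delta s t q -> designated (eval v q).
Proof.
move=> AG; rewrite eq_designated //; split=> [st _ [d Dd <-]|st d Dd].
  by rewrite eval_equiv_inst; apply: st.
by rewrite -eval_equiv_inst; apply: st; exists d.
Qed.

Section Filter.
Variables (B : algebra S) (F : set B).
Hypothesis filterF : forall G p (v : nat -> B),
  L G p -> (forall q, G q -> F (eval v q)) -> F (eval v p).

(** Formulas of [L] have variables in [nat]; coding a countable type by [pickle] lets the filter use
    entailments over any such type. Numbers that code no variable get the value [b0]. *)
Lemma filter_closed (V : countType) (G : set (term S V)) p (v : V -> B) :
    (forall A, Mod Gamma A -> forall w : V -> A,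
      (forall q, G q -> designated (eval w q)) -> designated (eval w p)) ->
  (forall q, G q -> F (eval v q)) -> F (eval v p).
Proof.
move=> Gp GF; case: (carrier_inhabited B) => b0.
pose s (x : V) : formula S := Var (pickle x).
pose w k := if unpickle k is Some x then v x else b0.
have ws t : eval w (subst s t) = eval v t.
  by rewrite eval_subst; congr (eval _ t); apply/funext => x; rewrite /= /w pickleK.
rewrite -ws; apply: (@filterF (subst s @` G)) => [|_ [q Gq <-]]; last first.
  by rewrite ws; apply: GF.
apply/logic_designated => A AG u Gu; rewrite eval_subst; apply: Gp => // q Gq.
by rewrite -eval_subst; apply: Gu; exists q.
Qed.

(* For a filter F this is the Leibniz congruence of F. *)
Definition filter_rel (a b : B) : Prop :=
  forall d, Delta d -> F (eval (pair_val a b) d).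

(** Replacing each equation by its [Delta]-formulas transfers equational entailments to
    [filter_rel]. The congruence properties then come from laws of equality. *)
Lemma filter_rel_closed (V : countType) (H : set (equation S V)) e (v : V -> B) :
    (forall A, Mod Gamma A -> forall w : V -> A,
      (forall e', H e' -> sat_eq w e') -> sat_eq w e) ->
    (forall e', H e' -> filter_rel (eval v e'.1) (eval v e'.2)) ->
  filter_rel (eval v e.1) (eval v e.2).
Proof.
move=> He HF d Dd; rewrite -eval_equiv_inst.
apply: (@filter_closed _ (\bigcup_(e' in H) equiv_inst Delta e'.1 e'.2)).
  move=> A AG w Hw; have /(equiv_instP _ _ _ AG) : sat_eq w e.
    apply: He => // e' He'; apply/(equiv_instP _ _ _ AG) => q e'q.
    by apply: Hw; exists e'.
  by apply; exists d.
by move=> _ [e' He' [d' Dd' <-]]; rewrite eval_equiv_inst; apply: HF.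
Qed.

Lemma filter_rel_refl a : filter_rel a a.
Proof.
by apply: (@filter_rel_closed unit set0 (Var tt, Var tt) (fun=> a)).
Qed.

Lemma filter_rel_sym a b : filter_rel a b -> filter_rel b a.
Proof.
move=> ab; apply: (@filter_rel_closed bool [set (Var true, Var false)]
  (Var false, Var true) (fun k => if k then a else b)).
  by move=> A AG w /(_ _ erefl) /= /esym.
by move=> _ ->.
Qed.

Lemma filter_rel_trans a b c : filter_rel a b -> filter_rel b c -> filter_rel a c.
Proof.
move=> ab bc; apply: (@filter_rel_closed nat
  [set e | e = (Var 0, Var 1) \/ e = (Var 1, Var 2)] (Var 0, Var 2)
  (nth a [:: a; b; c])).
  move=> A AG w wH; rewrite /sat_eq /=.
  exact: etrans (wH _ (or_introl erefl)) (wH _ (or_intror erefl)).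
by move=> _ [->|->].
Qed.

Lemma filter_rel_op f (a b : 'I_(arity f) -> B) :
  (forall k, filter_rel (a k) (b k)) -> filter_rel (op a) (op b).
Proof.
move=> ab; apply: (@filter_rel_closed ('I_(arity f) * bool)%type
  [set (Var (k, true), Var (k, false)) | k in setT]
  (App f (fun k => Var (k, true)), App f (fun k => Var (k, false)))
  (fun x => if x.2 then a x.1 else b x.1)).
  move=> A AG w wH; rewrite /sat_eq /=; congr op; apply/funext => k.
  exact: wH _ (ex_intro2 _ _ k I erefl).
by move=> _ [k _ <-] /=.
Qed.

(** Over the models of [Gamma], x is designated exactly when the formulas Delta(E(x)) are, so [F] is
    recovered from its congruence. *)
Lemma filter_relE a :
  F a <-> forall e, E e -> filter_rel (eval (fun=> a) e.1) (eval (fun=> a) e.2).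
Proof.
split=> [Fa e Ee d Dd|aE].
  rewrite -eval_equiv_inst.
  apply: (@filter_closed 'I_1 [set Var ord0]) => [A AG w wa|_ ->] //.
  apply: (equiv_instP w e.1 e.2 AG).1; last by exists d.
  have wE : w = fun=> w ord0 by apply/funext => k; rewrite [k]ord1.
  by rewrite wE; apply: (wa _ erefl e Ee).
rewrite -[a]/(eval (fun _ : 'I_1 => a) (Var ord0)).
apply: (@filter_closed 'I_1 (\bigcup_(e in E) equiv_inst Delta e.1 e.2)).
  move=> A AG w wE e Ee.
  have -> : (fun=> eval w (Var ord0)) = w by apply/funext => k; rewrite [k]ord1.
  by apply/(equiv_instP w _ _ AG) => q eq; apply: wE; exists e.
by move=> _ [e Ee [d Dd <-]]; rewrite eval_equiv_inst; apply: aE.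
Qed.

Lemma filter_quotient :
  exists (M : algebra S) (pi : B -> M) (r : M -> B),
    [/\ Mod Gamma M, forall q, pi (r q) = q,
        forall (V : Type) (v : V -> B) t, eval (pi \o v) t = pi (eval v t),
        forall a b, pi a = pi b <-> filter_rel a b
      & forall a, F a <-> designated (pi a)].
Proof.
have [M [pi [r [rK pi_eval piP]]]] := algebra_quotient filter_rel_refl
  filter_rel_sym filter_rel_trans filter_rel_op.
exists M, pi, r; split=> // [q Gq v prem|a].
  (* Lifting the valuation along [r] turns the quasi-identity into an entailment between pairs of
     [filter_rel]. *)
  have vE : v = pi \o (r \o v) by apply/funext => k /=; rewrite rK.
  rewrite vE /sat_eq !pi_eval; apply/piP.
  apply: (@filter_rel_closed nat [set e | List.In e (premises q)]) => [A|e eq].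
    by move/(_ q Gq).
  by apply/piP; rewrite -!pi_eval -vE; apply: prem.
rewrite filter_relE; split=> aE e Ee.
  have := aE e Ee; rewrite -piP -!pi_eval; exact.
by rewrite -piP -!pi_eval; apply: aE.
Qed.

End Filter.
End DeductiveFilters.

(** * Finitarity and the logic induced by a class *)

(* The pairs entailed by finite subsets of H form a congruence of the term
   algebra, and the quotient is a model of both Gamma and H. *)
Lemma eq_consequence_finitary (S : signature) (Gamma : set (quasi_identity S)) H e :
    eq_consequence (Mod Gamma) H e ->
  exists H0, [/\ finite_set H0, H0 `<=` H & eq_consequence (Mod Gamma) H0 e].
Proof.
pose entails H0 e := @eq_consequence S (Mod Gamma) H0 e.
have entails_mono H0 H1 u : H0 `<=` H1 -> entails H0 u -> entails H1 u.
  by move=> H01 H0u A AG v Hv; apply: H0u => // e' /H01; apply: Hv.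
pose R s t := exists H0, [/\ finite_set H0, H0 `<=` H & entails H0 (s, t)].
pose B := term_algebra S nat 0.
(* [R] is closed under entailment from finitely many pairs: merge their finite supports. *)
have entailed (D : set (equation S nat)) s t : finite_set D ->
    (forall d, D d -> R d.1 d.2) -> entails D (s, t) -> R s t.
  move=> finD DR Dst; have [|H0 [finH0 H0H H0D]] :=
    finite_support (G := H) (P := entails) finD entails_mono.
    by case=> a b /DR.
  by exists H0; split=> // A AG v H0v; apply: Dst => // d /H0D; apply.
have [] := @algebra_quotient S B R.
- by move=> s; exists set0; split=> //; apply: finite_set0.
- move=> s t st; apply: (entailed [set (s, t)]) => [|_ ->|A AG v] //.
  by move/(_ _ erefl)/esym.
- move=> s t u st tu; apply: (entailed ([set (s, t)] `|` [set (t, u)])).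
  + by rewrite finite_setU.
  + by move=> _ [->|->].
  + move=> A AG v Hv.
    exact: etrans (Hv _ (or_introl erefl)) (Hv _ (or_intror erefl)).
- move=> f a b ab; apply: (entailed [set (a k, b k) | k in setT]).
  + exact/finite_image/finite_finset.
  + by move=> _ [k _ <-]; apply: ab.
  + move=> A AG v Hv; rewrite /sat_eq /=; congr op; apply/funext => k.
    exact: Hv _ (ex_intro2 _ _ k I erefl).
move=> M [pi [r [rK pi_eval piP]]] He.
have pi_eq (s : nat -> B) (d : equation S nat) :
    sat_eq (pi \o s) d <-> R (subst s d.1) (subst s d.2).
  by rewrite -piP /sat_eq !pi_eval !eval_term_algebra.
have MG : Mod Gamma M.
  move=> q Gq v; have -> : v = pi \o (r \o v) by apply/funext => k /=; rewrite rK.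
  move=> prem; apply/pi_eq.
  apply: (entailed (subst_eq (r \o v) @` [set d | List.In d (premises q)])).
  + exact/finite_image/finite_In.
  + by move=> _ [d /prem/pi_eq dR <-].
  + move=> A AG w Hw; rewrite -[sat_eq _ _]/(sat_eq w (subst_eq _ _)) sat_subst.
    apply: (AG q Gq) => d dq; rewrite -sat_subst.
    by apply: Hw; exists d.
(* The canonical valuation satisfies [H], hence [e]; truth under it means that the two sides are
   related by [R]. *)
have : sat_eq (pi \o (Var : nat -> B)) e.
  apply: He => // d Hd; apply/pi_eq; rewrite !subst_Var.
  exists [set d]; split=> [|_ ->//|A AG v Hv]; first exact: finite_set1.
  by case: d Hd Hv => a b _; apply.
by rewrite pi_eq !subst_Var; case: e {He}.
Qed.

Lemma finite_preimage (T U : Type) (f : T -> U) (G : set T) (H : set U) :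
    finite_set H -> H `<=` f @` G ->
  exists G0, [/\ finite_set G0, G0 `<=` G & H `<=` f @` G0].
Proof.
move=> finH HG; apply: (finite_support (P := fun G0 y => (f @` G0) y)) => //.
  by move=> G0 G1 y G01 [x /G01 ? <-]; exists x.
move=> y /HG [x Gx <-]; exists [set x]; split=> [|_ -> //|]; last by exists x.
exact: finite_set1.
Qed.

Definition semantic_logic (S : signature) (K : algebra_class S)
    (E : set (equation S 'I_1)) : consequence S :=
  fun G p => forall A, K A -> forall v : nat -> A,
    (forall q, G q -> designated E (eval v q)) -> designated E (eval v p).

Lemma semantic_logicP (S : signature) (K : algebra_class S) E G p :
  semantic_logic K E G p <-> (forall e, defining_inst E p e ->
    eq_consequence K (\bigcup_(q in G) defining_inst E q) e).
Proof.
split=> [Gp e pe A AK v /designated_bigcup Gv|Gp A AK v Gv].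
  exact: ((designated_inst E v p).2 (Gp A AK v Gv) e pe).
by apply/designated_inst => e pe; apply: Gp => //; apply/designated_bigcup.
Qed.

(** For finitarity, designation of [p] reduces to the finitely many equations of [E0], and
    finitarity of equational consequence gives each a finite support. *)
Lemma semantic_is_logic (S : signature) (K : algebra_class S)
    (E E0 : set (equation S 'I_1)) :
    quasivariety K -> finite_set E0 -> E0 `<=` E ->
    (forall (A : algebra S) (a : A), K A -> designated E0 a -> designated E a) ->
  is_logic (semantic_logic K E).
Proof.
move=> [Gamma KE] finE0 E0E E0P; split.
- by move=> G p Gp A AK v; apply.
- by move=> G H p GH Gp A AK v Hv; apply: Gp => // q /GH; apply: Hv.
- by move=> G H p GH Hp A AK v Gv; apply: Hp => // q /GH; apply.
- move=> s G p Gp A AK v Gv; rewrite eval_subst; apply: Gp => // q Gq.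
  by rewrite -eval_subst; apply: Gv; exists q.
move=> G p Gp.
have [||H [finH HG HE0]] := finite_support (G := G) finE0
  (P := fun H e => eq_consequence K (\bigcup_(q in H) defining_inst E q)
                     (subst_eq (fun=> p) e)).
- move=> H H' e HH' He A AK v H'v; apply: He => // d [q Hq dq].
  by apply: H'v; exists q => //; apply: HH'.
- move=> e E0e.
  have KGamma : K = Mod Gamma by apply/funext => A; apply/propext.
  have := (semantic_logicP K E G p).1 Gp (subst_eq (fun=> p) e)
    (ex_intro2 _ _ e (E0E _ E0e) erefl).
  rewrite KGamma => /eq_consequence_finitary [X [finX XG Xe]].
  have [||H [finH HG HX]] := finite_support (G := G) finX
    (P := fun H d => (\bigcup_(q in H) defining_inst E q) d).
  + by move=> H H' d HH' [q /HH' ? ?]; exists q.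
  + move=> d /XG [q Gq qd]; exists [set q].
    by split=> [|_ ->//|]; [apply: finite_set1|exists q].
  by exists H; split=> // A AG v Hv; apply: Xe => // d /HX; apply: Hv.
exists H; split=> // A AK v Hv; apply: E0P => // e E0e.
have := HE0 e E0e A AK v; rewrite sat_subst; apply.
by apply/designated_bigcup.
Qed.

(** This allows a logic in the large language to be tested against a least logic in a smaller
    one. *)
Lemma is_logic_translate (S T : signature) (h : translation S T) C :
  is_logic C -> is_logic (fun G p => C (translate h (V:=nat) @` G) (translate h p)).
Proof.
move=> [Crefl Cmono Ccut Cstruct Cfin]; split.
- by move=> G p Gp; apply: Crefl; exists p.
- by move=> G H p GH; apply: Cmono => _ [q /GH Hq <-]; exists q.
- by move=> G H p GH; apply: Ccut => _ [q /GH Gq <-].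
- move=> s G p /(Cstruct (fun x => translate h (s x))).
  rewrite -translate_subst; apply: Cmono => _ [_ [q Gq <-] <-].
  by rewrite -translate_subst; exists (subst s q) => //; exists q.
move=> G p /Cfin [X [finX XG Xp]].
have [H [finH HG XH]] := finite_preimage finX XG.
by exists H; split=> //; apply: Cmono Xp.
Qed.

Lemma logic_filter (S : signature) (C : consequence S) G H p (s : nat -> formula S) :
  is_logic C -> C H p -> (forall q, H q -> C G (subst s q)) -> C G (subst s p).
Proof.
move=> Clogic /(logic_structural Clogic s) Hp HG.
by apply: (logic_cut Clogic) Hp => _ [q Hq <-]; apply: HG.
Qed.

(* E need not be finite, but finitely many of its equations imply the others: the
   formulas Delta(E(x)) yield x, hence finitely many of them do. *)
Lemma finite_defining (S : signature) (L : consequence S) Gamma Delta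
    (E : set (equation S 'I_1)) :
    algebraized_by L (Mod Gamma) Delta E ->
  exists E0, [/\ finite_set E0, E0 `<=` E &
    forall (A : algebra S) (a : A), Mod Gamma A -> designated E0 a -> designated E a].
Proof.
move=> algL; pose x : formula S := Var 0.
pose equiv (e : equation S 'I_1) :=
  equiv_inst Delta (subst (fun=> x) e.1) (subst (fun=> x) e.2).
have [|H [finH HE Hx]] := @logic_finitary _ _ (alg_logic algL) (\bigcup_(e in E) equiv e) x.
  apply/(logic_designated algL) => A AG v Ev e Ee.
  rewrite -[fun=> _]/(fun k : 'I_1 => eval v ((fun=> x) k)) -sat_subst.
  by apply/(equiv_instP algL v _ _ AG) => q eq; apply: Ev; exists e.
have [||E0 [finE0 E0E HE0]] := finite_support (G := E) finH
  (P := fun X q => (\bigcup_(e in X) equiv e) q).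
- by move=> X Y q XY [e /XY ? ?]; exists e.
- move=> q /HE [e Ee eq]; exists [set e].
  by split=> [|_ ->//|]; [apply: finite_set1|exists e].
exists E0; split=> // A a AG aE0.
(* With all variables sent to [a], the finite consequence says that [E0] at [a] forces [E] at
   [a]. *)
apply: ((logic_designated algL H x).1 Hx A AG (fun=> a)) => q /HE0 [e E0e].
apply: (equiv_instP algL (fun _ : nat => a) _ _ AG).1.
by rewrite !eval_subst; apply: aE0.
Qed.

Lemma designated_translate (S T : signature) (h : translation S T)
    (E : set (equation S 'I_1)) (A : algebra T) (a : A) :
  designated (translate_eq h (V:='I_1) @` E) a <-> designated E (a : reduct h A).
Proof.
split=> [aE e Ee|aE _ [e Ee <-]]; last by rewrite sat_translate; apply: aE.
by rewrite -[sat_eq _ _]sat_translate; apply: aE; exists e.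
Qed.

Section FreshValuation.
Variables (A : Type) (a0 : A) (n m : nat) (x : 'I_n -> A) (y z : 'I_m -> A).

(** The layout follows the variable numbering of [implicit_rules]. Truncated subtraction is
    harmless, as each test is reached only when the previous block is exceeded. *)
Definition fresh_val (k : nat) : A :=
  if insub k is Some i then x i else
  if insub (k - n) is Some j then y j else
  if insub (k - n - m) is Some j then z j else a0.

Lemma fresh_val_x (i : 'I_n) : fresh_val i = x i.
Proof. by rewrite /fresh_val valK. Qed.

Lemma fresh_val_y (j : 'I_m) : fresh_val (n + j) = y j.
Proof. by rewrite /fresh_val insubF ?addKn ?valK // ltnNge leq_addr. Qed.

Lemma fresh_val_z (j : 'I_m) : fresh_val (n + m + j) = z j.
Proof.
rewrite /fresh_val -addnA insubF; last by rewrite ltnNge leq_addr.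
by rewrite addKn insubF ?addKn ?valK // ltnNge leq_addr.
Qed.

End FreshValuation.

(** * The expanded class and soundness of the expanded logic *)

Section Expansion.
Variables (S : signature) (L : consequence S) (Gamma : set (quasi_identity S)).
Variables (Delta : set (term S 'I_2)) (E : set (equation S 'I_1)).
Hypothesis algL : algebraized_by L (Mod Gamma) Delta E.
Variables (I : Type) (n m : I -> nat).
Variables (Phi : forall i, set (term S ('I_(n i) + 'I_(m i)))).
Variables (phi : forall i, efd_matrix S (n i) (m i)).
Arguments Phi : clear implicits.
(** Covers both directions of the correspondence: formulas obtained from equations through [Delta],
    and equations obtained from formulas through [E]. *)
Hypothesis Phi_phi : forall i (A : algebra S) (v : 'I_(n i) + 'I_(m i) -> A), Mod Gamma A ->
  (forall p, Phi i p -> designated E (eval v p)) <->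
  (forall e, List.In e (phi i) -> sat_eq v e).

Local Notation T := (expand S n m).
Local Notation h := (incl S n m).
Local Notation K := (class_expansion Gamma phi).
Local Notation DeltaT := (translate h (V:='I_2) @` Delta).
Local Notation ET := (translate_eq h (V:='I_1) @` E).

(* The embedding of S in the language of the expansion by the i-th Phi only, the
   source of incl1. *)
Definition incl_unit (i : I) : translation S (expand1 S (n i) (m i)) :=
  incl S (fun=> n i) (fun=> m i).

Definition new_val (A : algebra T) (i : I) (x : 'I_(n i) -> A) : 'I_(m i) -> A :=
  fun j => op (a:=A) (f:=new_sym S n j) x.

(** The reduct of [A] along [incl1] and then [incl_unit] is [reduct h A] by conversion. *)
Lemma eval_incl1 (A : algebra T) i (v : nat -> A) (V : Type)
    (s : V -> formula (expand1 S (n i) (m i))) (t : term S V) :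
  eval v (translate (incl1 S n m i) (subst s (translate (incl_unit i) t))) =
  eval (fun u => eval v (translate (incl1 S n m i) (s u)) : reduct h A) t.
Proof.
rewrite eval_translate eval_subst eval_translate.
by under eq_fun do rewrite -eval_translate.
Qed.

Lemma eval_new_terms (A : algebra T) i (v : nat -> A) p :
  eval v (translate (incl1 S n m i)
    (subst (@new_terms S (n i) (m i)) (translate (incl_unit i) p))) =
  eval (join_val (fun k => v (nat_of_ord k)) (new_val (fun k => v (nat_of_ord k))) :
    _ -> reduct h A) p.
Proof. by rewrite eval_incl1; apply: (@eval_ext S (reduct h A)); case. Qed.

Lemma eval_fresh_vars (A : algebra T) i (v : nat -> A) off p :
  eval v (translate (incl1 S n m i)
    (subst (@fresh_vars _ (n i) (m i) off) (translate (incl_unit i) p))) =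
  eval (join_val (fun k => v (nat_of_ord k)) (fun j => v (off + j)) :
    _ -> reduct h A) p.
Proof. by rewrite eval_incl1; apply: (@eval_ext S (reduct h A)); case. Qed.

Lemma eval_equiv_vars (A : algebra T) i (v : nat -> A) k l d :
  eval v (translate (incl1 S n m i)
    (subst (fun j : 'I_2 => nth (Var k) [:: Var k; Var l] j) (translate (incl_unit i) d))) =
  eval (pair_val (v k) (v l) : _ -> reduct h A) d.
Proof. by rewrite eval_incl1; apply: (@eval_ext S (reduct h A)); case; case=> [|[]]. Qed.

(** Renumbering variables by naturals turns the new axioms into quasi-identities; U(phi) splits into
    one for each [j], a quasi-identity having a single conclusion. *)
Lemma class_expansion_quasivariety : quasivariety K.
Proof.
pose ren i (s : _ -> formula (expand1 S (n i) (m i))) (e : equation S ('I_(n i) + 'I_(m i))) :=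
  translate_eq (incl1 S n m i) (subst_eq s (translate_eq (incl_unit i) e)).
pose qE i e := QuasiIdentity [::] (ren i (@new_terms S (n i) (m i)) e).
pose qU i (j : 'I_(m i)) := QuasiIdentity
  (map (ren i (@fresh_vars _ (n i) (m i) (n i))) (phi i) ++
   map (ren i (@fresh_vars _ (n i) (m i) (n i + m i))) (phi i))
  (Var (n i + j), Var (n i + m i + j)).
have renE (A : algebra T) i (v : nat -> A) e :
    sat_eq v (ren i (@new_terms S (n i) (m i)) e) =
    sat_eq (join_val (fun k => v (nat_of_ord k)) (new_val (fun k => v (nat_of_ord k))))
      (translate_eq h e).
  by rewrite sat_translate /sat_eq /= !eval_new_terms.
have renU (A : algebra T) i (v : nat -> A) off e :
    sat_eq v (ren i (@fresh_vars _ (n i) (m i) off) e) =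
    sat_eq (join_val (fun k => v (nat_of_ord k)) (fun j => v (off + j)))
      (translate_eq h e).
  by rewrite sat_translate /sat_eq /= !eval_fresh_vars.
exists (translate_qi h @` Gamma `|`
  ([set q | exists i, exists2 e, List.In e (phi i) & q = qE i e] `|`
   [set q | exists i j, q = qU i j])) => A; split.
  case=> AG Aphi q [qG|[[i [e ephi ->]]|[i [j ->]]]]; first exact: AG.
    by move=> v _ /=; rewrite renE; apply: (Aphi i).1.
  move=> v prem; rewrite /sat_eq /=.
  apply: ((Aphi i).2 (fun k => v (nat_of_ord k)) (fun j => v (n i + j))
            (fun j => v (n i + m i + j))) => e ephi.
    by rewrite -renU; apply: prem; apply/List.in_or_app; left; apply/In_map; exists e.
  by rewrite -renU; apply: prem; apply/List.in_or_app; right; apply/In_map; exists e.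
move=> AG; split=> [q qG|i]; first by apply: AG; left.
have [a0] := carrier_inhabited A; split=> [x e ephi|x y z ey ez j].
  have := AG (qE i e) (or_intror (or_introl (ex_intro _ i (ex_intro2 _ _ e ephi erefl)))).
  (* The only variables of the identities are those of the block [x], so the other two blocks are
     empty. *)
  move/(_ (fresh_val a0 x (fun=> a0) (fun _ : 'I_0 => a0))) => /= qA.
  have := qA (fun e => False_ind _); rewrite renE.
  by under eq_fun do rewrite fresh_val_x.
have := AG (qU i j) (or_intror (or_intror (ex_intro _ i (ex_intro _ j erefl)))).
move/(_ (fresh_val a0 x y z)) => /= qA.
suff : sat_eq (fresh_val a0 x y z) (Var (n i + j), Var (n i + m i + j)).
  by rewrite /sat_eq /= fresh_val_y fresh_val_z.
apply: qA => e prem.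
have xE : (fun k : 'I_(n i) => fresh_val a0 x y z k) = x.
  by apply/funext => k; rewrite fresh_val_x.
have yE : (fun j : 'I_(m i) => fresh_val a0 x y z (n i + j)) = y.
  by apply/funext => k; rewrite fresh_val_y.
have zE : (fun j : 'I_(m i) => fresh_val a0 x y z (n i + m i + j)) = z.
  by apply/funext => k; rewrite fresh_val_z.
case: (List.in_app_or _ _ _ prem) => /In_map [d dphi <-]; rewrite renU xE ?yE ?zE; auto.
Qed.

Lemma reduct_Mod A : K A -> Mod Gamma (reduct h A).
Proof. by case=> /Mod_translate. Qed.

Lemma semantic_expansion_is_logic : is_logic (semantic_logic K ET).
Proof.
have [E0 [finE0 E0E E0P]] := finite_defining algL.
apply: (@semantic_is_logic _ _ _ (translate_eq h (V:='I_1) @` E0)).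
- exact: class_expansion_quasivariety.
- exact: finite_image.
- by move=> _ [e /E0E Ee <-]; exists e.
- by move=> A a KA /designated_translate aE0; apply/designated_translate/E0P => //;
    apply: reduct_Mod.
Qed.

(** By leastness it suffices that the semantic logic satisfies the generating rules. *)
Lemma expansion_sound : contains (semantic_logic K ET) (logic_expansion L Delta Phi).
Proof.
move=> G p; apply; first exact: semantic_expansion_is_logic.
move=> {p}_ _ [[G0 [p0 [Lp -> ->]]]|[i [G0 [p0 [Lp -> ->]]]]].
  move=> A KA v Gv; apply/designated_translate; rewrite eval_translate.
  apply: ((logic_designated algL G0 p0).1 Lp (reduct h A) (reduct_Mod KA)) => q Gq.
  by rewrite -eval_translate; apply/designated_translate/Gv; exists q.
(* A rule of a single expansion is itself given by leastness, so it is tested on the pullback of the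
   semantic logic along [incl1]. *)
apply: (Lp (fun G p => semantic_logic K ET (translate (incl1 S n m i) (V:=nat) @` G)
                         (translate (incl1 S n m i) p))).
  exact/is_logic_translate/semantic_expansion_is_logic.
move=> {}G0 {Lp}p0 [[G1 [p1 [Lp -> ->]]] A KA v Gv|].
  apply/designated_translate.
  rewrite -(subst_Var (translate _ p1)) eval_incl1.
  apply: ((logic_designated algL G1 p1).1 Lp (reduct h A) (reduct_Mod KA)) => q Gq.
  rewrite -eval_incl1 subst_Var; apply/designated_translate/Gv.
  by exists (translate (incl_unit i) q) => //; exists q.
case=> [p Pp A KA v _|j _ [_ [d Dd <-] <-] A KA v Gv].
  apply/designated_translate; rewrite eval_new_terms.
  apply: (Phi_phi _ (reduct_Mod KA)).2 Pp => e ephi.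
  by rewrite -sat_translate; apply: (KA.2 i).1.
apply/designated_translate; rewrite eval_equiv_vars.
apply: (eq_designated algL _ _ (reduct_Mod KA)).1 Dd.
apply: ((KA.2 i).2 (fun k => v (nat_of_ord k)) (fun j => v (n i + j))
          (fun j => v (n i + m i + j))) => e.
  rewrite sat_translate; apply: (Phi_phi _ (reduct_Mod KA)).1 => p Pp.
  rewrite -eval_fresh_vars; apply/designated_translate/Gv.
  by eexists; [left; exists p|].
rewrite sat_translate; apply: (Phi_phi _ (reduct_Mod KA)).1 => p Pp.
rewrite -eval_fresh_vars; apply/designated_translate/Gv.
by eexists; [right; exists p|].
Qed.

(** * Completeness through the quotient by a theory *)

Section Completeness.
Variables (D : consequence T) (G : set (formula T)).
Hypothesis D_logic : is_logic D.
Hypothesis D_old : contains D (image_logic h L).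
Hypothesis D_new :
  forall i, contains D (image_logic (incl1 S n m i) (logic_expansion1 L Delta (Phi i))).

Local Notation B := (term_algebra T nat 0).

(** Valuations in the term algebra are substitutions, so structurality and cut give closure of the
    theory under [L]. *)
Lemma theory_filter G0 p (v : nat -> reduct h B) :
  L G0 p -> (forall q, G0 q -> D G (eval v q)) -> D G (eval v p).
Proof.
move=> Lp GF.
have evalE t : eval v t = subst (v : nat -> term T nat) (translate h t).
  by rewrite -(eval_term_algebra (x:=0)) eval_translate.
rewrite evalE; apply: (@logic_filter _ _ _ (translate h (V:=nat) @` G0)) => //.
  by apply: D_old; exists G0, p.
by move=> _ [q Gq <-]; rewrite -evalE; apply: GF.
Qed.

Lemma theory_rule i H p (v : nat -> B) : implicit_rules Delta (Phi i) H p ->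
    (forall q, H q -> D G (eval v (translate (incl1 S n m i) q))) ->
  D G (eval v (translate (incl1 S n m i) p)).
Proof.
move=> Hp HG; rewrite eval_term_algebra.
apply: (@logic_filter _ _ _ (translate (incl1 S n m i) (V:=nat) @` H)) => //.
  apply: (@D_new i); exists H, p; split=> // C _; apply.
  by right.
by move=> _ [q Hq <-]; rewrite -(eval_term_algebra (x:=0)); apply: HG.
Qed.

Lemma theory_new i (x : 'I_(n i) -> B) p : Phi i p ->
  D G (eval (join_val x (new_val x) : _ -> reduct h B) p).
Proof.
move=> Pp; pose v := fresh_val (Var 0 : B) x (fun _ : 'I_0 => Var 0) (fun=> Var 0).
have xE : x = fun k => v (nat_of_ord k) by apply/funext => k; rewrite /v fresh_val_x.
rewrite xE -eval_new_terms; apply: theory_rule; first exact: rule_exists Pp.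
by [].
Qed.

(** The valuation [v] places [x], [y], [z] at the indices of the uniqueness rule, which moves the
    rule from variables to arbitrary terms. *)
Lemma theory_unique i (x : 'I_(n i) -> B) (y z : 'I_(m i) -> B) :
    (forall p, Phi i p -> D G (eval (join_val x y : _ -> reduct h B) p)) ->
    (forall p, Phi i p -> D G (eval (join_val x z : _ -> reduct h B) p)) ->
  forall j, filter_rel Delta (D G : set (reduct h B)) (y j) (z j).
Proof.
pose v := fresh_val (Var 0 : B) x y z.
have -> : x = fun k => v (nat_of_ord k) by apply/funext => k; rewrite /v fresh_val_x.
have -> : y = fun j => v (n i + j) by apply/funext => j; rewrite /v fresh_val_y.
have -> : z = fun j => v (n i + m i + j) by apply/funext => j; rewrite /v fresh_val_z.
move=> yPhi zPhi j d Dd; rewrite -(@eval_equiv_vars B i).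
apply: theory_rule.
  by apply: (@rule_unique _ Delta _ _ (Phi i) j); exists (translate (incl_unit i) d) => //; exists d.
move=> _ [[p Pp <-]|[p Pp <-]]; rewrite (@eval_fresh_vars B i).
  exact: yPhi.
exact: zPhi.
Qed.

Lemma lindenbaum_model :
  exists (A : algebra T) (v : nat -> A), K A /\
    forall p, D G p <-> designated ET (eval v p).
Proof.
(* [M] is taken apart so that the expanded algebra keeps its carrier and old operations; the reduct
   is then [M] by conversion. *)
have [[cM iM oM] [pi [r [MG rK pi_eval piP piF]]]] := filter_quotient algL theory_filter.
set M := Algebra iM oM in pi r MG rK pi_eval piP piF.
pose opA (f : sym T) : ('I_(arity f) -> cM) -> cM :=
  match f return ('I_(@arity T f) -> cM) -> cM with
  | inl f => oM f
  | inr g => fun a => pi (@op T B (inr g) (r \o a))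
  end.
pose A := @Algebra T cM iM opA.
have AG : Mod Gamma (reduct h A) by exact: MG.
(* The new operations respect the congruence: their values at [x] and at [y] both solve [Phi i] over
   [x] modulo it. *)
have pi_new i j (x y : 'I_(n i) -> B) : (forall k, pi (x k) = pi (y k)) ->
    pi (new_val x j) = pi (new_val y j).
  move=> xy; apply/piP; apply: (@theory_unique i x) => p Pp; first exact: theory_new.
  apply/piF; have := theory_new y Pp; rewrite piF -!pi_eval.
  suff -> : pi \o join_val x (new_val y) = pi \o join_val y (new_val y) by [].
  by apply/funext; case=> //= k; rewrite xy.
have evalA V (v : V -> B) t : eval (pi \o v : V -> A) t = pi (eval v t).
  elim: t => // [[f|[i j]]] a IHa.
    rewrite -[pi _](pi_eval _ (fun k => eval v (a k)) (App f Var)) /=.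
    by congr (oM f _); apply/funext.
  by apply: pi_new => k; exact: etrans (rK _) (IHa k).
(* Truth of [phi i] in the quotient becomes membership of [Phi i] at representatives in the theory,
   where the rules apply. *)
have lift i (x : 'I_(n i) -> A) (y : 'I_(m i) -> A) :
    (forall e, List.In e (phi i) -> sat_eq (join_val x y) (translate_eq h e)) <->
    (forall p, Phi i p -> D G (eval (join_val (r \o x) (r \o y) : _ -> reduct h B) p)).
  have vE : join_val x y = pi \o join_val (r \o x) (r \o y).
    by apply/funext; case=> k /=; rewrite rK.
  have := @Phi_phi i (reduct h A) (join_val x y) AG => PhiE.
  split=> [ephi p Pp|Fp e ephi].
    apply/piF; rewrite -pi_eval -vE; apply: PhiE.2 Pp => e /ephi.
    by rewrite sat_translate.
  rewrite sat_translate; apply: PhiE.1 e ephi => p Pp.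
  by rewrite vE; have := Fp p Pp; rewrite piF -pi_eval.
(* Under this valuation every formula evaluates to its own class. *)
exists A, (pi \o (Var : nat -> B)); split; last first.
  by move=> p; rewrite evalA eval_term_algebra subst_Var piF designated_translate.
split=> [|i]; first exact/Mod_translate.
split=> [x|x y z /lift yPhi /lift zPhi j].
  apply/lift => p Pp; have := theory_new (r \o x) Pp; rewrite !piF -!pi_eval.
  suff -> : pi \o join_val (r \o x) (r \o (fun j => op (a:=A) (f:=new_sym S n j) x)) =
    pi \o join_val (r \o x) (new_val (r \o x)) by [].
  by apply/funext; case=> //= j; rewrite rK.
by rewrite -(rK (y j)) -(rK (z j)); apply/piP/(theory_unique yPhi zPhi).
Qed.

End Completeness.

Lemma logic_expansionE : logic_expansion L Delta Phi = semantic_logic K ET.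
Proof.
apply/funext => G; apply/funext => p; apply/propext; split; first exact: expansion_sound.
move=> Gp D D_logic D_rules.
(* Under [v] the designated formulas are exactly the [D]-consequences of [G]; so [G] is designated,
   and with it [p]. *)
have [||A [v [KA DE]]] := @lindenbaum_model D G D_logic.
- by move=> H q Hq; apply: D_rules; left.
- by move=> i H q Hq; apply: D_rules; right; exists i.
apply/DE/Gp => // q Gq; apply/DE.
exact: (logic_refl D_logic).
Qed.

(** The translated [Delta] and [E] are evaluated in reducts, which are models of [Gamma], so their
    properties are inherited. *)
Theorem expansion_algebraized :
  algebraized_by (logic_expansion L Delta Phi) K DeltaT ET.
Proof.
have pairE (A : algebra T) (v : nat -> A) s t d : eval v (subst (fun k : 'I_2 => nth s [:: s; t] k)
    (translate h d)) = eval (pair_val (eval v s) (eval v t) : _ -> reduct h A) d.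
  by rewrite eval_equiv_inst eval_translate.
split.
- rewrite logic_expansionE; exact: semantic_expansion_is_logic.
- exact: class_expansion_quasivariety.
- by move=> G p; rewrite logic_expansionE; apply: semantic_logicP.
- move=> s t e [_ [_ [d Dd <-] <-] de] A KA v /(_ _ erefl) st.
  apply: ((designated_inst ET v _).2 _ e de); apply/designated_translate.
  by rewrite pairE; apply: (eq_designated algL _ _ (reduct_Mod KA)).1 Dd.
- move=> s t A KA v /designated_bigcup vD.
  apply: (eq_designated algL (A := reduct h A) _ _ (reduct_Mod KA)).2 => d Dd.
  rewrite -pairE; apply/designated_translate/vD.
  by eexists; first by exists d.
Qed.

End Expansion.

(** * Logic and class determine each other *)

Lemma eq_consequence_logic (S : signature) (C : consequence S) K D E
    (H : set (equation S nat)) e : algebraized_by C K D E ->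
  eq_consequence K H e <->
  forall q, equiv_inst D e.1 e.2 q -> C (\bigcup_(d in H) equiv_inst D d.1 d.2) q.
Proof.
move=> algC; have [Gamma KE] := alg_quasivariety algC.
have KGamma : K = Mod Gamma by apply/funext => A; apply/propext.
rewrite KGamma in algC *; split=> [He q eq|He A AG v Hv].
  apply/(logic_designated algC) => A AG v Hv.
  apply: (equiv_instP algC v e.1 e.2 AG).1 eq; apply: He => // d Hd.
  by apply/(equiv_instP algC v _ _ AG) => r dr; apply: Hv; exists d.
apply/(equiv_instP algC v _ _ AG) => q /He /(logic_designated algC); apply=> // r [d Hd dr].
exact: (equiv_instP algC v d.1 d.2 AG).1 (Hv d Hd) _ dr.
Qed.

(** Through [D] the logic fixes the equational consequences of the class, so each class satisfies
    the quasi-identities axiomatizing the other. *)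
Lemma equivalent_semantics_unique (S : signature) (C : consequence S) K K' D E :
  algebraized_by C K D E -> algebraized_by C K' D E -> K = K'.
Proof.
suff sub K1 K2 A : algebraized_by C K1 D E -> algebraized_by C K2 D E -> K1 A -> K2 A.
  by move=> CK CK'; apply/funext => A; apply/propext; split; apply: sub.
move=> C1 C2 AK1; have [Gamma KE] := alg_quasivariety C2; apply/KE => q Gq v.
suff : eq_consequence K1 [set d | List.In d (premises q)] (conclusion q) by apply.
apply/(eq_consequence_logic _ _ C1)/(eq_consequence_logic _ _ C2).
by move=> B /KE /(_ q Gq).
Qed.

(** [alg_complete] expresses the logic through [K] and [E] alone. *)
Lemma algebraized_logic_unique (S : signature) (C C' : consequence S) K D D' E :
  algebraized_by C K D E -> algebraized_by C' K D' E -> C = C'.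
Proof.
move=> CK CK'; apply/funext => G; apply/funext => p; apply/propext.
by rewrite (alg_complete CK) (alg_complete CK').
Qed.

(** * Passage between EFD-sentences and sets of formulas *)

Lemma sat_efd_formulas (S : signature) (L : consequence S) Gamma Delta E (n m : nat)
    (phi : efd_matrix S n m) (A : algebra S) (v : 'I_n + 'I_m -> A) :
    algebraized_by L (Mod Gamma) Delta E -> Mod Gamma A ->
  (forall p, efd_formulas Delta phi p -> designated E (eval v p)) <->
  (forall e, List.In e phi -> sat_eq v e).
Proof.
move=> algL AG; split=> [phiD e ephi|phiA p [e ephi ep]].
  by apply/(equiv_instP algL v _ _ AG) => p ep; apply: phiD; exists e.
exact: (equiv_instP algL v e.1 e.2 AG).1 (phiA e ephi) p ep.
Qed.

Lemma finite_efd_formulas (S : signature) (Delta : set (term S 'I_2)) (n m : nat)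
    (phi : efd_matrix S n m) :
  finite_set Delta -> finite_set (efd_formulas Delta phi).
Proof.
move=> finD; apply: bigcup_finite => [|e _]; first exact: finite_In.
exact: finite_image.
Qed.

(** Each formula is replaced by its defining equations, taken from a finite [E0] equivalent to [E]
    over the models of [Gamma] to keep the list finite. *)
Lemma formulas_efd (S : signature) (L : consequence S) Gamma Delta E (n m : nat)
    (Phi : set (term S ('I_n + 'I_m))) :
    algebraized_by L (Mod Gamma) Delta E -> finite_set Phi ->
  exists phi : efd_matrix S n m, forall (A : algebra S) (v : 'I_n + 'I_m -> A),
    Mod Gamma A -> (forall p, Phi p -> designated E (eval v p)) <->
                   (forall e, List.In e phi -> sat_eq v e).
Proof.
move=> algL finPhi; have [E0 [finE0 E0E E0P]] := finite_defining algL.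
have [|phi phiE] := @finite_set_seq _ (\bigcup_(p in Phi) defining_inst E0 p).
  by apply: bigcup_finite => // p _; apply: finite_image.
exists phi => A v AG; split=> [PhiA e /phiE|phiA].
  apply: (designated_bigcup E0 v Phi).2 => p /PhiA pE d /E0E; exact: pE.
have PhiE0 : forall p, Phi p -> designated E0 (eval v p).
  by apply/designated_bigcup => e /phiE; apply: phiA.
by move=> p /PhiE0; apply: E0P.
Qed.

Theorem theorem3p1 (S : signature) (L : consequence S)
    (Gamma : set (quasi_identity S))
    (Delta : set (term S 'I_2)) (E : set (equation S 'I_1))
    (Delta_finite : finite_set Delta)
    (L_algebraizable : algebraized_by L (Mod Gamma) Delta E)
    (Sigma : set (efd_sentence S)) :
  algebraized_by (set_logic_expansion Sigma L Delta)
    (set_class_expansion Sigma Gamma)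
    (translate (set_incl Sigma) (V:=_) @` Delta)
    (translate_eq (set_incl Sigma) (V:=_) @` E)
  /\
  (forall (I : Type) (n m : I -> nat), (forall i, 0 < m i) ->
     one_to_one (@is_logic_expansion S L Delta I n m)
       (@is_class_expansion S Gamma I n m)
       (fun C K => algebraized_by C K
          (translate (incl S n m) (V:=_) @` Delta)
          (translate_eq (incl S n m) (V:=_) @` E))).
Proof.
(* This gives the first claim and the passage from classes to logics. *)
have efd_algebraized (I : Type) (n m : I -> nat)
    (phi : forall i, efd_matrix S (n i) (m i)) :=
  expansion_algebraized L_algebraizable
    (fun i A v => sat_efd_formulas (phi i) v L_algebraizable).
split=> [|I n m _]; first exact: efd_algebraized.
split=> [C [Phi [finPhi ->]]|K [phi ->]].
  (* The partner of the logic is the class defined by equations equivalent to each [Phi i]. *)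
  pose phi i := cid (formulas_efd L_algebraizable (finPhi i)).
  have algC := expansion_algebraized L_algebraizable (fun i => svalP (phi i)).
  eexists; split; first by split; [eexists|exact: algC].
  by move=> K [_ algK]; apply: equivalent_semantics_unique algC algK.
have algK := efd_algebraized I n m phi.
exists (logic_expansion L Delta (fun i => efd_formulas Delta (phi i))); split.
  split=> //; eexists; split; last by [].
  (* Finiteness of [Delta] enters here: the sets defining an expansion of [L] must be finite. *)
  by move=> i; apply: finite_efd_formulas.
by move=> C [_ algC]; apply: algebraized_logic_unique algK algC.
Qed.
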